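(* A graph $G$ is an isometric daisy graph of a Hamming graph $H=K_{k_1}\Box\cdots\Box K_{k_n}$ with respect to $0^n$, where $H$ is the smallest possible, if and only if $G$ can be obtained (up to isomorphism) from the one-vertex graph $K_1$ by a sequence of daisy peripheral expansions.
   Context: $V(H)=\prod_{i=1}^n\{0,\dots,k_i-1\}$, vertices adjacent iff they differ in exactly one coordinate. For a Hamming graph $K$ with all-zero vertex $0$ and $X\subseteq V(K)$, the daisy graph $K_0(X)$ is the subgraph of $K$ induced by $\bigcup_{v\in X}I_K(0,v)$ ($I_K(a,b)$: vertices on shortest $a,b$-paths); isometric means distance-preserving. ''$H$ is the smallest possible'' means $G$ is not such a daisy graph of a Hamming graph with fewer or smaller factors. Expansion (Chepoi): for a connected graph $G'$ and subsets $W_0,\dots,W_l$ of $V(G')$ with pairwise nonempty intersections, union $V(G')$, no edges between $W_i\setminus W_j$ and $W_j\setminus W_i$, and all $\langle W_i\rangle$, $\langle W_i\cup W_j\rangle$ isometric in $G'$, the expansion replaces each vertex $x$ by a clique on vertices $x_i$ (one for each $i$ with $x\in W_i$) and joins $x_iy_i$ whenever $xy\in E(G')$ and $x,y\in W_i$. It is peripheral if some $W_i=V(G')$. If $G'$ is a daisy graph of a Hamming graph $K$ with respect to its all-zero vertex (the one-vertex graph being regarded as the daisy graph of the empty product), a peripheral expansion relative to $W_0=V(G'),W_1,\dots,W_l$ is a daisy peripheral expansion if each $\langle W_i\rangle_K$ ($1\le i\le l$) is a daisy graph of $K$ with respect to the all-zero vertex. *)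

(* Defs.v *)
From HB Require Import structures.
From mathcomp Require Import all_boot.

Set Implicit Arguments.
Unset Strict Implicit.
Unset Printing Implicit Defensive.

Record sgraph := SGraph {
  vertex :> finType;
  adj : rel vertex;
  adj_sym : symmetric adj;
  adj_irr : irreflexive adj
}.

Definition graph_iso (G1 G2 : sgraph) : Prop :=
  exists f : G1 -> G2, bijective f /\ {mono f : x y / adj x y}.

Section InducedSubgraph.
Variables (G : sgraph) (A : {set G}).

Definition induced_adj : rel {x : G | x \in A} := fun x y => adj (val x) (val y).

Lemma induced_sym : symmetric induced_adj.
Proof. by move=> x y; rewrite /induced_adj adj_sym. Qed.

Lemma induced_irr : irreflexive induced_adj.
Proof. by move=> x; rewrite /induced_adj adj_irr. Qed.

Definition induced : sgraph := SGraph induced_sym induced_irr.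

End InducedSubgraph.

Section Metric.
Variable G : sgraph.

(* [x :: p] is a shortest path from x to y. *)
Definition geodesic (x y : G) (p : seq G) : Prop :=
  [/\ path (@adj G) x p, last x p = y
    & forall q, path (@adj G) x q -> last x q = y -> size p <= size q].

(* The distance is a relation, so that vertices in different components are
   at no distance (rather than at some default natural number). *)
Definition is_dist (x y : G) (d : nat) : Prop :=
  exists2 p, geodesic x y p & size p = d.

Definition in_interval (a b v : G) : Prop :=
  exists2 p, geodesic a b p & v \in a :: p.

Definition connected : Prop := forall x y : G, connect (@adj G) x y.

End Metric.

Definition isometric (G : sgraph) (A : {set G}) : Prop :=
  forall (x y : induced A) (d : nat),
    is_dist x y d <-> is_dist (val x : G) (val y : G) d.

Section Complete.
Variable n : nat.

Definition complete_adj : rel 'I_n := fun x y => x != y.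

Lemma complete_sym : symmetric complete_adj.
Proof. by move=> x y; rewrite /complete_adj eq_sym. Qed.

Lemma complete_irr : irreflexive complete_adj.
Proof. by move=> x; rewrite /complete_adj eqxx. Qed.

Definition complete : sgraph := SGraph complete_sym complete_irr.

End Complete.

(* The i-th factor is the complete graph on (k i).+1 vertices, i.e. the usual
   k_i >= 1 is (k i).+1; hence the all-zero vertex always exists. For n = 0
   this is the empty product, a one-vertex graph. *)
Section Hamming.
Variables (n : nat) (k : 'I_n -> nat).

Definition hvertex : finType := {dffun forall i : 'I_n, 'I_(k i).+1}.

Definition hamming_adj : rel hvertex :=
  fun u v => #|[set i | u i != v i]| == 1.

Lemma hamming_sym : symmetric hamming_adj.
Proof.
move=> u v; rewrite /hamming_adj; congr (#|pred_of_set _| == 1).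
by apply/setP => i; rewrite !inE eq_sym.
Qed.

Lemma hamming_irr : irreflexive hamming_adj.
Proof.
move=> u; rewrite /hamming_adj.
suff -> : [set i | u i != u i] = set0 by rewrite cards0.
by apply/setP => i; rewrite !inE eqxx.
Qed.

Definition hamming : sgraph := SGraph hamming_sym hamming_irr.

Definition hzero : hamming := [ffun i : 'I_n => (ord0 : 'I_(k i).+1)].

(* A is the vertex set of the daisy graph K_0(X), for some X. *)
Definition daisy_set (A : {set hamming}) : Prop :=
  exists X : {set hamming},
    forall v, v \in A <-> exists2 x, x \in X & in_interval hzero x v.

End Hamming.

(* f is an isomorphism from G onto the subgraph induced by its image. *)
Definition induced_embedding (G H : sgraph) (f : G -> H) : Prop :=
  injective f /\ {mono f : x y / adj x y}.

Definition isometric_daisy_graph (G : sgraph) (n : nat) (k : 'I_n -> nat) :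
    Prop :=
  exists f : G -> hamming k,
    [/\ induced_embedding f, daisy_set (f @: [set: G])
      & isometric (f @: [set: G])].

(* The Hamming graph of k' has fewer factors than that of k, or equally many
   that are, up to reordering, no larger and not all of the same size. *)
Definition fewer_or_smaller (m : nat) (k' : 'I_m -> nat)
    (n : nat) (k : 'I_n -> nat) : Prop :=
  m < n \/
  exists s : 'I_m -> 'I_n,
    [/\ bijective s, forall j, k' j <= k (s j) & exists j, k' j < k (s j)].

Definition smallest_isometric_daisy_graph (G : sgraph)
    (n : nat) (k : 'I_n -> nat) : Prop :=
  isometric_daisy_graph G k /\
  forall (m : nat) (k' : 'I_m -> nat),
    fewer_or_smaller k' k -> ~ isometric_daisy_graph G k'.

Section Expansion.
Variables (G : sgraph) (l : nat) (W : 'I_l.+1 -> {set G}).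

Definition expansion_family : Prop :=
  [/\ connected G,
      forall i j, i != j -> W i :&: W j != set0,
      \bigcup_i W i = [set: G],
      forall i j x y, x \in W i :\: W j -> y \in W j :\: W i -> ~~ adj x y
    & (forall i, isometric (W i)) /\
      (forall i j, isometric (W i :|: W j))].

(* The pair (x, i) is the copy x_i of x. *)
Definition exp_vertex : finType := {p : G * 'I_l.+1 | p.1 \in W p.2}.

Definition exp_adj : rel exp_vertex := fun u v =>
  let: (x, i) := val u in let: (y, j) := val v in
  (x == y) && (i != j) || (i == j) && adj x y.

Lemma exp_sym : symmetric exp_adj.
Proof.
move=> [[x i] ?] [[y j] ?]; rewrite /exp_adj /=.
by rewrite (eq_sym x) (eq_sym i) adj_sym.
Qed.

Lemma exp_irr : irreflexive exp_adj.
Proof. by move=> [[x i] ?]; rewrite /exp_adj /= !eqxx adj_irr. Qed.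

Definition expansion : sgraph := SGraph exp_sym exp_irr.

End Expansion.

Definition daisy_peripheral_expansion (G' G : sgraph) : Prop :=
  exists (l : nat) (W : 'I_l.+1 -> {set G'}),
    [/\ expansion_family W,
        W ord0 = [set: G'],
        exists (n : nat) (k : 'I_n -> nat) (f : G' -> hamming k),
          [/\ induced_embedding f, daisy_set (f @: [set: G'])
            & forall i, i != ord0 -> daisy_set (f @: W i)]
      & graph_iso G (expansion W)].

Inductive obtained_by_daisy_expansions : sgraph -> Prop :=
| obtained_K1 (G : sgraph) :
    graph_iso G (complete 1) -> obtained_by_daisy_expansions G
| obtained_step (G' G : sgraph) :
    obtained_by_daisy_expansions G' -> daisy_peripheral_expansion G' G ->
    obtained_by_daisy_expansions G.

(* Main.v *)
(** A set of vertices of a Hamming graph is a daisy set iff it is closed under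
    setting coordinates to zero, and it is isometric iff from each of its
    vertices one can move, inside it, closer to any other of its vertices.

    Splitting an isometric daisy graph into layers along one coordinate
    exhibits it as a daisy peripheral expansion of its zero layer, relative to
    the nonempty layers; the number of coordinates drops, so this iterates down
    to [K_1]. Conversely the expansion of [G'] embeds into the product of [K]
    with a clique on [l+1] vertices. The definition of a daisy peripheral expansion only provides some daisy
    embedding [f] of [G'], possibly unrelated to the isometric one coming from
    the previous steps; but each coordinate class of edges of [f] is generated
    by triangles and squares, so it lies in one coordinate of the isometric
    embedding, which forces [f] to be isometric. A smallest Hamming graph
    exists as soon as some Hamming graph is available. *)

Require Import Defs.
From mathcomp Require Import all_boot.
From Stdlib Require Import Classical.

Set Implicit Arguments.
Unset Strict Implicit.
Unset Printing Implicit Defensive.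

(** * Graph distance and isometry through local descent *)

Definition descending (G : sgraph) (D : G -> G -> nat) (A : {set G}) : Prop :=
  forall x y, x \in A -> y \in A -> x != y ->
    exists z, [/\ z \in A, adj x z & D z y < D x y].

Definition lipschitz (G : sgraph) (D : G -> G -> nat) : Prop :=
  (forall x, D x x = 0) /\ (forall x y z, adj x z -> D x y <= (D z y).+1).

Lemma lipschitz_path (G : sgraph) (D : G -> G -> nat) (x : G) (p : seq G) :
  lipschitz D -> path (@adj G) x p -> D x (last x p) <= size p.
Proof.
move=> [D0 DL]; elim: p x => [|z p IH] x /=; first by rewrite D0.
by case/andP=> xz /IH h; apply: leq_trans (DL _ _ _ xz) _.
Qed.

Lemma descending_path (G : sgraph) (D : G -> G -> nat) (x y : G) :
  descending D [set: G] ->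
  exists p, [/\ path (@adj G) x p, last x p = y & size p <= D x y].
Proof.
move=> DD; move: {2}(D x y) (leqnn (D x y)) => m.
elim: m x => [|m IH] x.
  case: (eqVneq x y) => [-> _|xy]; first by exists [::].
  have [z [_ _]] := DD x y (in_setT _) (in_setT _) xy.
  by rewrite leqn0 => h /eqP e; rewrite e in h.
case: (eqVneq x y) => [-> _|xy]; first by exists [::].
have [z [_ xz h]] := DD x y (in_setT _) (in_setT _) xy => hm.
have [p [pp lp sp]] := IH z (leq_trans h hm).
by exists (z :: p); split => //=; [rewrite xz | apply: leq_ltn_trans sp h].
Qed.

(** The Lipschitz bound forces every path from [x] to [y] to have length at least [D x y], and
    greedy descent produces a path that is no longer. *)
Lemma is_dist_metric (G : sgraph) (D : G -> G -> nat) :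
  lipschitz D -> descending D [set: G] ->
  forall (x y : G) (d : nat), is_dist x y d <-> d = D x y.
Proof.
move=> DL DD x y d; have [p [pp lp sp]] := descending_path x y DD; split.
  move=> [q [pq lq mq] <-]; apply/eqP; rewrite eqn_leq.
  rewrite (leq_trans (mq _ pp lp) sp) /=.
  by rewrite -{1}lq; apply: lipschitz_path.
move=> ->; exists p.
  split=> // q pq lq; apply: leq_trans sp _.
  by rewrite -{1}lq; apply: lipschitz_path.
by apply/eqP; rewrite eqn_leq sp -{1}lp lipschitz_path.
Qed.

(** The Lipschitz bound survives restriction to [A], so descent within [A] makes [D] the distance of
    the induced subgraph too. Conversely, the first step of a shortest path inside [A] is a descent
    step. *)
Lemma isometricP (G : sgraph) (D : G -> G -> nat) (A : {set G}) :
  lipschitz D -> descending D [set: G] ->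
  isometric A <-> descending D A.
Proof.
move=> DL DD; have distG := is_dist_metric DL DD; split.
  move=> isoA x y xA yA xy.
  have /isoA [[|z p] [pp lp _] sp] :
      is_dist (val (exist _ x xA : induced A))
              (val (exist _ y yA : induced A)) (D x y) by apply/distG.
    by case: lp => e; rewrite e eqxx in xy.
  move: pp => /= /andP [xz pp]; exists (val z); split; [exact: valP | exact: xz |].
  rewrite -sp /= ltnS.
  have -> : y = last (val z) (map val p) by move: lp => /= lp; rewrite last_map lp.
  rewrite -(size_map val p); apply: lipschitz_path => //.
  by rewrite path_map.
move=> DA x y d.
have DL' : @lipschitz (induced A) (fun x y => D (val x) (val y)).
  by case: DL => D0 DL; split=> [u|u v w uw]; [apply: D0 | apply: DL].
have DD' : @descending (induced A) (fun x y => D (val x) (val y)) [set: _].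
  move=> u v _ _ uv.
  have [z [zA uz h]] := DA _ _ (valP u) (valP v) uv.
  by exists (exist _ z zA); split.
have h1 := is_dist_metric DL' DD' x y d; have h2 := distG (val x) (val y) d.
by rewrite h1 h2.
Qed.

Lemma descending_connected (G : sgraph) (D : G -> G -> nat) :
  descending D [set: G] -> connected G.
Proof.
move=> DD x y; have [p [pp lp _]] := descending_path x y DD.
by apply/connectP; exists p.
Qed.

(** * Hamming distance, intervals and daisy sets *)

Section HammingMetric.
Variables (n : nat) (k : 'I_n -> nat).
Implicit Types (u v w : hamming k) (A : {set hamming k}) (S : {set 'I_n}).

Definition diff u v : {set 'I_n} := [set i | u i != v i].

Definition hdist u v : nat := #|diff u v|.

(** Two uses matter: a singleton [S] gives one step from [u] towards [v], and [v = hzero k] erases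
    the coordinates in [S]. *)
Definition mix S u v : hamming k := [ffun i => if i \in S then v i else u i].

Lemma diffC u v : diff u v = diff v u.
Proof. by apply/setP=> i; rewrite !inE eq_sym. Qed.

Lemma diff_eq0 u v : (diff u v == set0) = (u == v).
Proof.
apply/eqP/eqP=> [/setP h|->]; last by apply/setP=> i; rewrite !inE eqxx.
by apply/ffunP=> i; have := h i; rewrite !inE; move/negbFE/eqP.
Qed.

Lemma hamming_adjE u v : adj u v = (hdist u v == 1).
Proof. by []. Qed.

Lemma diff_mixl S u v : diff u (mix S u v) = S :&: diff u v.
Proof.
by apply/setP=> i; rewrite !inE ffunE; case: (i \in S) => //; rewrite eqxx.
Qed.

Lemma diff_mixr S u v : diff (mix S u v) v = diff u v :\: S.
Proof.
by apply/setP=> i; rewrite !inE ffunE; case: (i \in S) => //; rewrite eqxx.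
Qed.

Lemma adj_mix1 i u v : u i != v i -> adj u (mix [set i] u v).
Proof.
move=> h; rewrite hamming_adjE /hdist diff_mixl (setIidPl _) ?cards1 //.
by rewrite sub1set inE.
Qed.

Lemma hdist_mix1 i u v : u i != v i -> hdist u v = (hdist (mix [set i] u v) v).+1.
Proof.
by move=> h; rewrite /hdist diff_mixr (cardsD1 i (diff u v)) inE h.
Qed.

Lemma hdistxx u : hdist u u = 0.
Proof. by apply/eqP; rewrite cards_eq0 diff_eq0. Qed.

Lemma hdist_lipschitz : lipschitz (fun u v : hamming k => hdist u v).
Proof.
split=> [u|u v w]; first exact: hdistxx.
rewrite hamming_adjE => /eqP h; rewrite -addn1 addnC -h.
apply: leq_trans (leq_card_setU (diff u w) (diff w v)).
apply/subset_leq_card/subsetP=> i; rewrite !inE.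
by case: (eqVneq (u i) (w i)) => // ->.
Qed.

Lemma neq_diff u v : u != v -> exists i, u i != v i.
Proof.
by rewrite -diff_eq0 => /set0Pn [i]; rewrite inE; exists i.
Qed.

Lemma hdist_descending : descending (fun u v => hdist u v) [set: hamming k].
Proof.
move=> u v _ _ /neq_diff [i h]; exists (mix [set i] u v).
by split; [rewrite inE | apply: adj_mix1 | rewrite (hdist_mix1 h)].
Qed.

(** An edge changes a single coordinate [i]; unless the new value is [v i], every disagreement of
    [u] with [v] persists in [w]. *)
Lemma closer_neighbor u v w :
  adj u w -> hdist w v < hdist u v ->
  exists2 i, u i != v i & w = mix [set i] u v.
Proof.
rewrite hamming_adjE => /cards1P [i /setP d] h.
have same j : j != i -> w j = u j.
  by move=> ji; have := d j; rewrite !inE (negbTE ji); move/negbFE/eqP.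
have wi : w i = v i.
  apply/eqP; apply: contraLR h => wi; rewrite -leqNgt.
  apply/subset_leq_card/subsetP=> j; rewrite !inE.
  by case: (eqVneq j i) => [->//|ji]; rewrite same.
exists i; first by rewrite -wi; have := d i; rewrite !inE eqxx.
apply/ffunP=> j; rewrite ffunE inE.
by case: (eqVneq j i) => [->//|/same].
Qed.

Lemma isometric_descending A :
  isometric A <-> descending (fun u v => hdist u v) A.
Proof. exact: isometricP hdist_lipschitz hdist_descending. Qed.

Lemma hamming_geodesic u v :
  exists2 p, geodesic u v p & size p = hdist u v.
Proof. exact/(is_dist_metric hdist_lipschitz hdist_descending). Qed.

(** Cut a shortest path at [w], or concatenate shortest paths through [w]. The inequality [<=]
    suffices, since the reverse one is the triangle inequality. *)
Lemma in_intervalP u v w :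
  in_interval u v w <-> hdist u w + hdist w v <= hdist u v.
Proof.
split.
  move=> [p gp wp].
  have : size p = hdist u v.
    by apply/(is_dist_metric hdist_lipschitz hdist_descending); exists p.
  case: gp wp => pp lp _ wp; case/splitPl: p / wp pp lp => p1 p2 l1.
  rewrite cat_path last_cat size_cat l1 => /andP [pp1 pp2] l2 <-.
  apply: leq_add.
    by rewrite -{1}l1; apply: (lipschitz_path hdist_lipschitz).
  by rewrite -{1}l2; apply: (lipschitz_path hdist_lipschitz).
move=> h.
have [p1 [pp1 l1 _] s1] := hamming_geodesic u w.
have [p2 [pp2 l2 _] s2] := hamming_geodesic w v.
exists (p1 ++ p2).
  split; first by rewrite cat_path pp1 l1.
    by rewrite last_cat l1.
  move=> q pq lq; rewrite size_cat s1 s2; apply: leq_trans h _.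
  by rewrite -{1}lq; apply: (lipschitz_path hdist_lipschitz).
by rewrite -l1 -cat_cons mem_cat mem_last.
Qed.

Lemma in_interval_zero u v :
  in_interval (hzero k) u v <-> exists S, v = mix S u (hzero k).
Proof.
rewrite in_intervalP; split=> [h|[S ->]].
  exists [set i | v i == hzero k i].
  (* Equality in the triangle inequality leaves no coordinate in which [v] differs from both zero
     and [u]. *)
  have h2 : diff (hzero k) v :&: diff v u == set0.
    rewrite -cards_eq0 -leqn0 -(leq_add2l #|diff (hzero k) v :|: diff v u|).
    rewrite cardsUI addn0; apply: leq_trans h _.
    apply/subset_leq_card/subsetP=> i; rewrite !inE.
    by case: (eqVneq (hzero k i) (v i)) => // ->.
  apply/ffunP=> i; rewrite ffunE inE.
  move/eqP/setP: h2 => /(_ i); rewrite !inE eq_sym.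
  by case: (eqVneq (v i) (hzero k i)) => //= _ /negbFE/eqP.
rewrite [hdist (mix _ _ _) _]/hdist diffC diff_mixl /hdist (diffC _ (mix _ _ _)).
rewrite diff_mixr (diffC (hzero k)).
by rewrite addnC setIC cardsID.
Qed.

(** Erasing [T] and then [S] erases their union, so intervals from zero are closed under erasing;
    conversely, a closed set serves as its own generating set [X]. *)
Lemma daisy_setP A :
  daisy_set A <-> forall u S, u \in A -> mix S u (hzero k) \in A.
Proof.
split=> [[X hX] u S /hX [x xX /in_interval_zero [T ->]]|h].
  apply/hX; exists x => //; apply/in_interval_zero; exists (S :|: T).
  by apply/ffunP=> i; rewrite !ffunE !inE; case: (i \in S); case: (i \in T).
exists A => v; split=> [vA|[x xA /in_interval_zero [S ->]]]; last exact: h.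
exists v => //; apply/in_interval_zero; exists set0.
by apply/ffunP=> i; rewrite !ffunE inE.
Qed.

(** If [u v] and [u w] were edges in different coordinates, [v] and [w] would differ in both of
    them. *)
Lemma diff_triangle u v w :
  adj u v -> adj v w -> adj u w -> diff u v = diff u w.
Proof.
rewrite !hamming_adjE /hdist => /cards1P [a da] /cards1P [b db] /cards1P [c dc].
have mem_u i : (u i != v i) = (i == a) by move/setP/(_ i): da; rewrite !inE.
have mem_v i : (v i != w i) = (i == b) by move/setP/(_ i): db; rewrite !inE.
have mem_w i : (u i != w i) = (i == c) by move/setP/(_ i): dc; rewrite !inE.
rewrite da dc; case: (eqVneq a c) => [->//|ac].
have /eqP uw : u a == w a by rewrite -[_ == _]negbK mem_w.
have ab : a = b by apply/eqP; rewrite -mem_v -uw eq_sym mem_u.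
have := mem_w c; rewrite eqxx.
have /eqP -> : u c == v c by rewrite -[_ == _]negbK mem_u eq_sym.
by rewrite mem_v -ab eq_sym (negbTE ac).
Qed.

(** The first two edges use different coordinates because [u] and [w] are neither equal nor
    adjacent. The change made by the first edge must be undone by the third or the fourth; if only
    the fourth undoes it, then [x] equals [v]. *)
Lemma diff_square u v w x :
  adj u v -> adj v w -> adj w x -> adj x u ->
  u != w -> v != x -> ~~ adj u w -> diff u v = diff x w.
Proof.
rewrite !hamming_adjE /hdist => /cards1P [a da] /cards1P [b db].
move=> /cards1P [d dd] /cards1P [c dc] uw vx nuw.
have e1 i : i != a -> u i = v i.
  by move=> h; move/setP/(_ i): da; rewrite !inE (negbTE h) => /negbFE/eqP.
have e2 i : i != b -> v i = w i.
  by move=> h; move/setP/(_ i): db; rewrite !inE (negbTE h) => /negbFE/eqP.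
have e3 i : i != d -> w i = x i.
  by move=> h; move/setP/(_ i): dd; rewrite !inE (negbTE h) => /negbFE/eqP.
have e4 i : i != c -> x i = u i.
  by move=> h; move/setP/(_ i): dc; rewrite !inE (negbTE h) => /negbFE/eqP.
have n1 : u a != v a by move/setP/(_ a): da; rewrite !inE eqxx.
have n2 : v b != w b by move/setP/(_ b): db; rewrite !inE eqxx.
have ab : a != b.
  apply: contraNneq nuw => ab; rewrite -ab in e2 n2.
  have sub : diff u w \subset [set a].
    apply/subsetP=> i; rewrite !inE; apply: contraR => h.
    by rewrite (e1 _ h) (e2 _ h).
  rewrite eqn_leq -{1}(cards1 a) subset_leq_card //=.
  by rewrite card_gt0 diff_eq0.
rewrite da diffC dd; congr [set _]; apply/eqP; apply: contraNT vx => ad.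
have ca : a = c.
  apply/eqP; apply: contraNT n1 => ac.
  by rewrite -(e4 _ ac) -(e3 _ ad) (e2 _ ab).
have bd : b = d.
  apply/eqP; apply: contraNT n2 => bd; rewrite (e3 _ bd).
  by rewrite e4 -?ca 1?eq_sym // e1 // eq_sym.
apply/eqP/ffunP=> i; case: (eqVneq i a) => [->|ia].
  by rewrite (e2 _ ab) (e3 _ ad).
by rewrite e4 -?ca // e1.
Qed.

End HammingMetric.

Lemma adj_single (n : nat) (k : 'I_n -> nat) (u v : hamming k) (i : 'I_n) :
  u i != v i -> (forall j, j != i -> u j = v j) -> adj u v.
Proof.
move=> ui uj; rewrite hamming_adjE; apply/cards1P; exists i.
apply/setP=> j; rewrite !inE; case: (eqVneq j i) => [->//|/uj ->].
by rewrite eqxx.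
Qed.

Lemma adj_eq_off (n : nat) (k : 'I_n -> nat) (u v : hamming k) (i j : 'I_n) :
  adj u v -> u i != v i -> j != i -> u j = v j.
Proof.
rewrite hamming_adjE => /cards1P [a /setP d] ui ji.
have /eqP ia : i == a by have := d i; rewrite !inE ui.
by have := d j; rewrite !inE -ia (negbTE ji) => /negbFE/eqP.
Qed.

(** * Rigidity: each coordinate of a daisy embedding lies in one coordinate of any other
    embedding *)

Section DaisyRigidity.
Variables (G : sgraph) (n m : nat) (k : 'I_n -> nat) (r : 'I_m -> nat).
Variables (f : G -> hamming k) (g : G -> hamming r).
Hypotheses (f_emb : induced_embedding f) (g_emb : induced_embedding g).
Hypothesis f_daisy : daisy_set (f @: [set: G]).

Lemma daisy_lower x (S : {set 'I_n}) : exists y, f y = mix S (f x) (hzero k).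
Proof.
have /daisy_setP h := f_daisy.
have /imsetP [y _ e] := h (f x) S (imset_f f (in_setT x)).
by exists y.
Qed.

(** Erasing a coordinate [j] other than the direction [i] of the edge either fixes both ends or
    moves the edge to the opposite side of a square, to which [diff_square] applies in the image of
    [g]. *)
Lemma diff_zero1 x y x' y' i j :
  adj x y -> f x i != f y i -> j != i ->
  f x' = mix [set j] (f x) (hzero k) -> f y' = mix [set j] (f y) (hzero k) ->
  diff (g x) (g y) = diff (g x') (g y').
Proof.
case: f_emb g_emb => fI fM [gI gM] xy xyi ji ex ey.
have fxy := xy; rewrite -fM in fxy.
have e := adj_eq_off fxy xyi ji.
have v1 a b c : f b = mix [set j] (f a) (hzero k) -> c != j -> f b c = f a c.
  by move=> ->; rewrite ffunE inE => /negbTE ->.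
have v2 a b : f b = mix [set j] (f a) (hzero k) -> f b j = hzero k j.
  by move=> ->; rewrite ffunE inE eqxx.
have ij : i != j by rewrite eq_sym.
case: (eqVneq (f x j) (hzero k j)) => xj.
  have stay a b : f b = mix [set j] (f a) (hzero k) -> f a j = hzero k j -> b = a.
    move=> h ha; apply: fI; apply/ffunP=> c; case: (eqVneq c j) => [->|cj].
      by rewrite (v2 _ _ h).
    exact: v1 h cj.
  by rewrite (stay _ _ ex xj) (stay _ _ ey _) // -e.
have yj : f y j != hzero k j by rewrite -e.
have nx : f x i != f y' i by rewrite (v1 _ _ _ ey ij).
have nxj : f x j != f y' j by rewrite (v2 _ _ ey).
apply: diff_square; rewrite ?gM ?(inj_eq gI) //.
- by rewrite -fM ey adj_mix1.
- rewrite -fM adj_sym; apply: (@adj_single _ _ _ _ i).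
    by rewrite (v1 _ _ _ ey ij) (v1 _ _ _ ex ij).
  move=> c ci; have ec := adj_eq_off fxy xyi ci.
  by rewrite ex ey !ffunE ec.
- by rewrite adj_sym -fM ex adj_mix1.
- by apply: contraNneq nx => ->.
- by apply: contraNneq xyi => ->; rewrite (v1 _ _ _ ex ij).
- by rewrite -fM; apply: contra nxj => h; rewrite (adj_eq_off h nx ji).
Qed.

(** The coordinates of [S] are erased one at a time; the daisy property keeps the intermediate
    vertices in the image of [f]. *)
Lemma diff_zero (S : {set 'I_n}) x y x' y' i :
  adj x y -> f x i != f y i -> i \notin S ->
  f x' = mix S (f x) (hzero k) -> f y' = mix S (f y) (hzero k) ->
  diff (g x) (g y) = diff (g x') (g y').
Proof.
case: f_emb => fI fM xy xyi.
have [c] := ubnP #|S|; elim: c S x' y' => // c IH S x' y' Sc iS ex ey.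
case: (set_0Vmem S) => [S0|[j jS]].
  have stay a b : f b = mix S (f a) (hzero k) -> b = a.
    by move=> h; apply: fI; apply/ffunP=> d; rewrite h S0 ffunE inE.
  by rewrite (stay _ _ ex) (stay _ _ ey).
have [x1 ex1] := daisy_lower x (S :\ j).
have [y1 ey1] := daisy_lower y (S :\ j).
have iSj : i \notin S :\ j by rewrite inE negb_and iS orbT.
rewrite (IH (S :\ j) x1 y1) //; last by move: Sc; rewrite (cardsD1 j) jS.
have n1 : f x1 i != f y1 i by rewrite ex1 ey1 !ffunE (negbTE iSj).
have compose (u : hamming k) :
    mix S u (hzero k) = mix [set j] (mix (S :\ j) u (hzero k)) (hzero k).
  apply/ffunP=> d; rewrite !ffunE !inE.
  by case: (eqVneq d j) => [->|]//=; rewrite jS.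
apply: (diff_zero1 _ n1 (j := j)).
- rewrite -fM; apply: (adj_single n1) => d di; rewrite ex1 ey1 !ffunE.
  by rewrite -fM in xy; rewrite (adj_eq_off xy xyi di).
- by apply: contraNneq iS => <-.
- by rewrite ex ex1 compose.
- by rewrite ey ey1 compose.
Qed.

(** Erasing all coordinates but [i] moves the edge onto the [i]-th axis. There it either ends at [o]
    or forms a triangle with [o], so that it can be traded for an edge at [o]. *)
Lemma diff_axis x y i o :
  adj x y -> f x i != f y i -> f o = hzero k ->
  exists z, [/\ f z i != hzero k i, forall j, j != i -> f z j = hzero k j
              & diff (g x) (g y) = diff (g o) (g z)].
Proof.
case: f_emb g_emb => fI fM [gI gM] xy xyi eo.
have [x0 ex] := daisy_lower x (~: [set i]).
have [y0 ey] := daisy_lower y (~: [set i]).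
have ax a b j : f b = mix (~: [set i]) (f a) (hzero k) -> j != i ->
    f b j = hzero k j.
  by move=> -> ji; rewrite ffunE !inE ji.
have n0 : f x0 i != f y0 i by rewrite ex ey !ffunE !inE eqxx.
have oadj z : f z i != hzero k i -> (forall j, j != i -> f z j = hzero k j) ->
    adj z o.
  by move=> h1 h2; rewrite -fM eo; apply: (adj_single h1).
have xy0 : adj x0 y0.
  rewrite -fM; apply: (adj_single n0) => j ji.
  by rewrite (ax _ _ _ ex ji) (ax _ _ _ ey ji).
rewrite (diff_zero xy xyi _ ex ey) ?inE ?eqxx //.
have isO z : f z i = hzero k i -> (forall j, j != i -> f z j = hzero k j) ->
    z = o.
  move=> h1 h2; apply: fI; rewrite eo; apply/ffunP=> j.
  by case: (eqVneq j i) => [->|/h2].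
have [xi|xi] := eqVneq (f x0 i) (hzero k i).
  exists y0; split; first by rewrite -xi eq_sym.
    by move=> j; apply: ax ey.
  by rewrite (isO x0 xi) // => j; apply: ax ex.
exists x0; split=> //; first by move=> j; apply: ax ex.
have [yi|yi] := eqVneq (f y0 i) (hzero k i).
  by rewrite (isO y0 yi) 1?diffC // => j; apply: ax ey.
rewrite [RHS]diffC; apply: diff_triangle; rewrite ?gM //.
  by apply: oadj => // j; apply: ax ey.
by apply: oadj => // j; apply: ax ex.
Qed.

(** Both edges are replaced by edges from the origin [o] along axis [i]; these coincide or are two
    sides of a triangle. *)
Lemma diff_same_coordinate x y x' y' i :
  adj x y -> f x i != f y i -> adj x' y' -> f x' i != f y' i ->
  diff (g x) (g y) = diff (g x') (g y').
Proof.
case: f_emb g_emb => fI fM [gI gM] xy xyi xy' xyi'.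
have [o eo] := daisy_lower x [set: 'I_n].
have {}eo : f o = hzero k by rewrite eo; apply/ffunP=> j; rewrite ffunE inE.
have [z [z1 z2 ->]] := diff_axis xy xyi eo.
have [w [w1 w2 ->]] := diff_axis xy' xyi' eo.
have [->//|zw] := eqVneq z w.
apply: diff_triangle; rewrite gM -fM ?eo.
- by rewrite adj_sym; apply: (adj_single z1).
- apply: (@adj_single _ _ _ _ i); last by move=> j ji; rewrite z2 ?w2.
  apply: contra zw => /eqP e; rewrite -(inj_eq fI); apply/eqP/ffunP=> j.
  by case: (eqVneq j i) => [->//|ji]; rewrite z2 ?w2.
- by rewrite adj_sym; apply: (adj_single w1).
Qed.

(** A set rather than one coordinate, because [G] may have no edge in direction [i]. *)
Definition edge_class (i : 'I_n) : {set 'I_m} :=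
  [set c | [exists x, exists y,
    [&& adj x y, f x i != f y i & g x c != g y c]]].

Lemma edge_classP i c :
  reflect (exists x y, [/\ adj x y, f x i != f y i & g x c != g y c])
          (c \in edge_class i).
Proof.
rewrite inE; apply: (iffP existsP) => [[x /existsP [y /and3P h]]|[x [y h]]].
  by exists x, y.
by exists x; apply/existsP; exists y; apply/and3P.
Qed.

Lemma card_edge_class i : #|edge_class i| <= 1.
Proof.
apply/card_le1_eqP=> c d /edge_classP [x [y [xy xyi xyc]]].
move=> /edge_classP [x' [y' [xy' xyi' xyd]]].
have e := diff_same_coordinate xy xyi xy' xyi'.
case: g_emb => gI gM; move: xy; rewrite -gM hamming_adjE => /cards1P [a da].
have : c \in diff (g x) (g y) by rewrite inE.
have : d \in diff (g x) (g y) by rewrite e inE.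
by rewrite da !inE => /eqP -> /eqP ->.
Qed.

(** Erase, one by one, the coordinates in which [f x] differs from [f y]. The path stays in the
    image of [f], and the first edge that changes [g] in coordinate [c] is the required witness. *)
Lemma lower_edge_class x y c :
  (forall i, f x i != f y i -> f y i = hzero k i) -> g x c != g y c ->
  exists2 i, f x i != f y i & c \in edge_class i.
Proof.
case: f_emb => fI fM.
have [d] := ubnP (hdist (f x) (f y)); elim: d x => // d IH x hd low xyc.
have : f x != f y by apply: contraNneq xyc => /fI ->.
case/neq_diff=> i xyi; have [z ez] := daisy_lower x [set i].
have {}ez : f z = mix [set i] (f x) (f y).
  rewrite ez; apply/ffunP=> j; rewrite [LHS]ffunE [RHS]ffunE inE.
  by case: (eqVneq j i) => // ->; rewrite low.
have [zc|zc] := eqVneq (g x c) (g z c); last first.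
  exists i => //; apply/edge_classP; exists x, z; split=> //.
    by rewrite -fM ez adj_mix1.
  by rewrite ez ffunE inE eqxx.
have sub j : f z j != f y j -> f x j != f y j.
  by rewrite ez ffunE inE; case: (j == i) => //; rewrite eqxx.
have [] := IH z; last by move=> j /sub; exists j.
- by move: hd; rewrite (hdist_mix1 xyi) -ez.
- by move=> j /sub; apply: low.
- by rewrite -zc.
Qed.

(** Every coordinate changed between [g x] and [g y] belongs to the class of a coordinate changed
    between [f x] and [f y], and a class has at most one element. *)
Lemma hdist_daisy_le x y : hdist (g x) (g y) <= hdist (f x) (f y).
Proof.
(* Both [x] and [y] descend to [z] by erasing coordinates in which they differ, so
   [lower_edge_class] applies on either side. *)
have [z ez] := daisy_lower x (diff (f x) (f y)).
have zE j : f x j = f y j -> f z j = f y j.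
  by move=> e; rewrite ez ffunE inE e eqxx.
have z0 j : f x j != f y j -> f z j = hzero k j.
  by move=> e; rewrite ez ffunE inE e.
have sub : diff (g x) (g y) \subset \bigcup_(i in diff (f x) (f y)) edge_class i.
  apply/subsetP=> c; rewrite inE => xyc; apply/bigcupP.
  have [xz|xz] := eqVneq (g x c) (g z c).
    have [||i yz ci] := @lower_edge_class y z c.
    - by move=> i; case: (eqVneq (f x i) (f y i)) => [/zE ->|/z0//]; rewrite eqxx.
    - by rewrite -xz eq_sym.
    - exists i => //; rewrite inE; by apply: contraNneq yz => /zE ->.
  have [||i yz ci] := @lower_edge_class x z c.
  - move=> i; case: (eqVneq (f x i) (f y i)) => [e|/z0//].
    by rewrite (zE _ e) e eqxx.
  - by [].
  - exists i => //; rewrite inE; apply: contraNneq yz => e.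
    by rewrite (zE _ e) e.
apply: leq_trans (subset_leq_card sub) _.
have le_sum : #|\bigcup_(i in diff (f x) (f y)) edge_class i|
              <= \sum_(i in diff (f x) (f y)) #|edge_class i|.
  elim/big_ind2: _ => [|A a B b hA hB|//]; first by rewrite cards0.
  by apply: leq_trans (leq_add hA hB); rewrite leq_card_setU.
apply: leq_trans le_sum _; rewrite /hdist -sum1_card.
by apply: leq_sum => i _; apply: card_edge_class.
Qed.

End DaisyRigidity.

Lemma isometric_embedding (G : sgraph) (n : nat) (k : 'I_n -> nat)
    (f : G -> hamming k) :
  induced_embedding f ->
  isometric (f @: [set: G]) <->
  descending (fun x y => hdist (f x) (f y)) [set: G].
Proof.
case=> fI fM; rewrite isometric_descending; split=> h.
  move=> x y _ _ xy.
  have fxy : f x != f y by rewrite (inj_eq fI).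
  have [_ [/imsetP [z _ ->] xz lt]] :=
    h _ _ (imset_f f (in_setT x)) (imset_f f (in_setT y)) fxy.
  by exists z; rewrite -fM.
move=> _ _ /imsetP [x _ ->] /imsetP [y _ ->]; rewrite (inj_eq fI) => xy.
have [z [_ xz lt]] := h x y (in_setT _) (in_setT _) xy.
by exists (f z); rewrite fM imset_f ?inE.
Qed.

Lemma embedding_lipschitz (G : sgraph) (n : nat) (k : 'I_n -> nat)
    (f : G -> hamming k) :
  induced_embedding f -> lipschitz (fun x y => hdist (f x) (f y)).
Proof.
case=> fI fM; have [h0 hL] := hdist_lipschitz k; split=> [x|x y z xz].
  exact: h0.
by apply: hL; rewrite fM.
Qed.

(** Shortest paths for [g] bound the [f]-distance by the [g]-distance, and rigidity gives the
    reverse bound; hence the two agree and descent carries over. *)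
Lemma daisy_embedding_isometric (G : sgraph) (n m : nat)
    (k : 'I_n -> nat) (r : 'I_m -> nat)
    (f : G -> hamming k) (g : G -> hamming r) :
  induced_embedding f -> daisy_set (f @: [set: G]) ->
  induced_embedding g -> isometric (g @: [set: G]) ->
  isometric (f @: [set: G]).
Proof.
move=> fE fD gE /(isometric_embedding gE) gdesc.
apply/(isometric_embedding fE).
have le x y : hdist (f x) (f y) <= hdist (g x) (g y).
  have [p [pp lp sp]] := descending_path x y gdesc.
  apply: leq_trans sp; rewrite -{1}lp.
  exact: (lipschitz_path (embedding_lipschitz fE)).
have eqd x y : hdist (f x) (f y) = hdist (g x) (g y).
  by apply/eqP; rewrite eqn_leq le (hdist_daisy_le fE gE fD).
move=> x y xT yT xy; have [z [zT xz lt]] := gdesc x y xT yT xy.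
by exists z; rewrite !eqd.
Qed.

(** * Adding a first coordinate to a Hamming graph *)

Section ExtendVertex.
Variables (n : nat) (k : 'I_n.+1 -> nat) (k' : 'I_n -> nat).
Hypothesis kE : forall j, k' j = k (lift ord0 j).

(* [inord] spares a cast along [kE]; it is the identity on the values used
   here as long as [a <= k ord0]. *)
Definition ext (a : nat) (x : hamming k') : hamming k :=
  [ffun i => inord (if unlift ord0 i is Some j then nat_of_ord (x j) else a)].

Lemma ext_ord0 a x : a <= k ord0 -> ext a x ord0 = a :> nat.
Proof. by move=> ak; rewrite ffunE unlift_none inordK. Qed.

Lemma ext_lift a x j : ext a x (lift ord0 j) = x j :> nat.
Proof. by rewrite ffunE liftK inordK // -kE. Qed.

Lemma hdist_ext a b x y :
  a <= k ord0 -> b <= k ord0 ->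
  hdist (ext a x) (ext b y) = (a != b) + hdist x y.
Proof.
move=> ak bk.
have sumE m (r : 'I_m -> nat) (u v : hamming r) :
    hdist u v = \sum_i (u i != v i).
  rewrite /hdist -sum1_card big_mkcond /=; apply: eq_bigr => i _.
  by rewrite inE; case: (u i != v i).
rewrite !sumE big_ord_recl; congr (_ + _).
  by rewrite -(inj_eq val_inj) /= !ext_ord0.
by apply: eq_bigr => j _; rewrite -(inj_eq val_inj) /= !ext_lift.
Qed.

Lemma ext_inj a b x y :
  a <= k ord0 -> b <= k ord0 -> ext a x = ext b y -> a = b /\ x = y.
Proof.
move=> ak bk e; have := hdist_ext x y ak bk.
rewrite e hdistxx => /esym/eqP.
by rewrite addn_eq0 eqb0 negbK cards_eq0 diff_eq0 => /andP [/eqP -> /eqP ->].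
Qed.

Lemma mix_ext S a b x y :
  a <= k ord0 -> b <= k ord0 ->
  mix S (ext a x) (ext b y) =
    ext (if ord0 \in S then b else a) (mix (lift ord0 @^-1: S) x y).
Proof.
move=> ak bk; apply/ffunP=> i; apply: val_inj; rewrite ffunE.
case: (unliftP ord0 i) => [j|] ->.
  by rewrite [RHS]ext_lift [in RHS]ffunE inE; case: ifP => _; rewrite /= ext_lift.
by rewrite [RHS]ext_ord0; case: ifP => _ //; rewrite /= ext_ord0.
Qed.

Lemma ext_zero : hzero k = ext 0 (hzero k').
Proof.
apply/ffunP=> i; apply: val_inj; rewrite ffunE.
case: (unliftP ord0 i) => [j|] ->; last by rewrite [RHS]ext_ord0.
by rewrite [RHS]ext_lift ffunE.
Qed.

End ExtendVertex.

Lemma ext_split (n : nat) (k : 'I_n.+1 -> nat) (u : hamming k) :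
  exists x, u = ext k (k' := fun j => k (lift ord0 j)) (u ord0) x.
Proof.
exists [ffun j => u (lift ord0 j)]; apply/ffunP=> i; apply: val_inj.
case: (unliftP ord0 i) => [j|] ->; last first.
  by rewrite [RHS]ext_ord0 // -ltnS ltn_ord.
by rewrite [RHS]ext_lift // ffunE.
Qed.

(** * Expansions as subgraphs of a product with one more factor *)

Section ExpansionEmbedding.
Variables (G' : sgraph) (n : nat) (k : 'I_n.+1 -> nat) (k' : 'I_n -> nat).
Hypothesis kE : forall j, k' j = k (lift ord0 j).
Variables (f : G' -> hamming k') (l : nat) (W : 'I_l.+1 -> {set G'}).
Variable h : 'I_l.+1 -> nat.
Hypotheses (f_emb : induced_embedding f) (h_inj : injective h).
Hypothesis h_le : forall i, h i <= k ord0.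

(** The labels [h] stay general: they are the indices themselves when an expansion is embedded, and
    the values of the nonempty layers when a daisy graph is split. *)
Definition exp_embed (p : expansion W) : hamming k :=
  ext k (h (val p).2) (f (val p).1).

Lemma hdist_exp_embed p q :
  hdist (exp_embed p) (exp_embed q) =
    ((val p).2 != (val q).2) + hdist (f (val p).1) (f (val q).1).
Proof. by rewrite hdist_ext // (inj_eq h_inj). Qed.

Lemma exp_embed_induced : induced_embedding exp_embed.
Proof.
case: f_emb => fI fM; split.
  move=> p q /(ext_inj kE (h_le _) (h_le _)) [/h_inj e2 /fI e1].
  by apply: val_inj; move: e1 e2; case: (val p) (val q) => x i [y j] /= -> ->.
move=> p q; rewrite hamming_adjE hdist_exp_embed; case: p q => [[x i] xi] [[y j] yj].
rewrite /adj /= /exp_adj /=; case: (eqVneq i j) => _ /=.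
  by rewrite andbF -fM hamming_adjE.
by rewrite orbF andbT addnC addn1 eqSS cards_eq0 diff_eq0 (inj_eq fI).
Qed.

End ExpansionEmbedding.

Lemma graph_iso_daisy (G1 G2 : sgraph) (n : nat) (k : 'I_n -> nat) :
  graph_iso G1 G2 -> isometric_daisy_graph G2 k -> isometric_daisy_graph G1 k.
Proof.
move=> [p [pB pM]] [f [[fI fM] fD fiso]]; exists (f \o p).
have -> : (f \o p) @: [set: G1] = f @: [set: G2].
  apply/setP=> u; apply/imsetP/imsetP=> [[x _ ->]|[y _ ->]].
    by exists (p x).
  by case: pB => q qK Kq; exists (q y); rewrite //= Kq.
split=> //; split; first by apply: inj_comp => //; apply: bij_inj.
by move=> x y; rewrite -pM -fM.
Qed.

Lemma embeddings_iso (G1 G2 H : sgraph) (f1 : G1 -> H) (f2 : G2 -> H) :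
  induced_embedding f1 -> induced_embedding f2 ->
  f1 @: [set: G1] = f2 @: [set: G2] -> graph_iso G1 G2.
Proof.
move=> [I1 M1] [I2 M2] e.
have ex1 x : exists y, f2 y == f1 x.
  have : f1 x \in f2 @: [set: G2] by rewrite -e imset_f.
  by case/imsetP=> y _ ->; exists y.
have ex2 y : exists x, f1 x == f2 y.
  have : f2 y \in f1 @: [set: G1] by rewrite e imset_f.
  by case/imsetP=> x _ ->; exists x.
have h1 x : f2 (xchoose (ex1 x)) = f1 x by apply/eqP/(xchooseP (ex1 x)).
have h2 y : f1 (xchoose (ex2 y)) = f2 y by apply/eqP/(xchooseP (ex2 y)).
exists (fun x => xchoose (ex1 x)); split; last by move=> x y; rewrite -M2 !h1 M1.
exists (fun y => xchoose (ex2 y)) => x; first by apply: I1; rewrite h2 h1.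
by apply: I2; rewrite h1 h2.
Qed.

Lemma expansion_daisy (G' G : sgraph) (m : nat) (r : 'I_m -> nat) :
  isometric_daisy_graph G' r -> daisy_peripheral_expansion G' G ->
  exists (n : nat) (k : 'I_n -> nat), isometric_daisy_graph G k.
Proof.
move=> [g [gE gD giso]] [l [W [fam W0 [n [k' [f [fE fD WD]]]] isoG]]].
have /(isometric_embedding fE) fdesc := daisy_embedding_isometric fE fD gE giso.
have fL := embedding_lipschitz fE.
(* The new factor is a clique on [l.+1] vertices, encoded by [l] since factor [i] has [(k i).+1]
   vertices. *)
pose k (i : 'I_n.+1) := if unlift ord0 i is Some j then k' j else l.
have kE j : k' j = k (lift ord0 j) by rewrite /k liftK.
have le_k (i : 'I_l.+1) : i <= k ord0 by rewrite /k unlift_none -ltnS.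
exists n.+1, k; apply: graph_iso_daisy isoG _.
have nat_inj : injective (@nat_of_ord l.+1) by apply: val_inj.
exists (exp_embed k f (W := W) (@nat_of_ord l.+1)).
have FE := exp_embed_induced kE W fE nat_inj le_k.
split=> //.
  apply/daisy_setP=> _ S /imsetP [[[x i] xi] _ ->].
  rewrite /exp_embed (ext_zero kE) mix_ext //.
  have /daisy_setP Wcl : daisy_set (f @: W i).
    by case: (eqVneq i ord0) => [->|/WD//]; rewrite W0.
  have /imsetP [y yi ->] := Wcl (f x) (lift ord0 @^-1: S) (imset_f f xi).
  have y0 : y \in W ord0 by rewrite W0 inE.
  (* Erasing the new coordinate leads to the copy with index [ord0], which exists because [W ord0]
     is everything. *)
  apply/imsetP; case: ifP => _.
    by exists (exist _ (y, ord0) y0).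
  by exists (exist _ (y, i) yi).
apply/(isometric_embedding FE)=> p q _ _ pq.
case: fam => _ _ _ noedge [Wiso WWiso].
have Wdesc A : isometric A -> descending (fun x y => hdist (f x) (f y)) A.
  by move/(isometricP _ fL fdesc).
case: p q pq => [[x i] xi] [[y j] yj] pq.
have [eij|ij] := eqVneq i j.
  subst j; have xy : x != y.
    by apply: contra pq => /eqP e; subst y; apply/eqP/val_inj.
  have [z [zi xz lt]] := Wdesc _ (Wiso i) _ _ xi yj xy.
  exists (exist _ (z, i) zi); split=> //.
    by rewrite /adj /= /exp_adj /= eqxx xz orbT.
  by rewrite !hdist_exp_embed //= eqxx.
(* With different indices, switch to the copy in [W j] if [x] has one; otherwise descend in the
   union of [W i] and [W j]. *)
have [xj|xj] := boolP (x \in W j).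
  exists (exist _ (x, j) xj); split=> //.
    by rewrite /adj /= /exp_adj /= eqxx ij.
  by rewrite !hdist_exp_embed //= eqxx ij.
have xy : x != y by apply: contraNneq xj => ->.
have [|||z [zij xz lt]] := Wdesc _ (WWiso i j) x y.
- by rewrite inE xi.
- by rewrite inE yj orbT.
- by [].
(* The step cannot leave [W i], as no edge joins the two set differences. *)
have zi : z \in W i.
  move: zij; rewrite inE; case: (boolP (z \in W i)) => //= zi zj.
  by have := noedge i j x z; rewrite !inE xi xj zi zj xz => /(_ isT isT).
exists (exist _ (z, i) zi); split=> //.
  by rewrite /adj /= /exp_adj /= eqxx xz orbT.
by rewrite !hdist_exp_embed //= ij.
Qed.

(** Used to index the nonempty layers with [ord0] reserved for the zero layer, which must become
    [W ord0]. *)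
Lemma pointed_enumeration (T : finType) (S : {set T}) (x0 : T) :
  x0 \in S ->
  exists (l : nat) (h : 'I_l.+1 -> T),
    [/\ injective h, h ord0 = x0 & forall x, x \in S <-> exists i, h i = x].
Proof.
move=> x0S; pose s := x0 :: enum (S :\ x0).
exists (size (enum (S :\ x0))), (fun i => nth x0 s i); split=> //.
  have us : uniq s by rewrite /= mem_enum !inE eqxx enum_uniq.
  move=> i j e; apply: val_inj; apply/eqP.
  by rewrite -(nth_uniq x0 (ltn_ord i : i < size s) (ltn_ord j : j < size s) us) e.
have memS x : (x \in S) = (x \in s).
  by rewrite /s in_cons mem_enum !inE; case: (eqVneq x x0) => // ->.
move=> x; rewrite memS; split=> [xs|[i <-]]; last exact: mem_nth.
have lt : index x s < size s by rewrite index_mem.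
by exists (Ordinal lt); rewrite /= nth_index.
Qed.

(** * Layers of an isometric daisy set along the first coordinate *)

Section Layers.
Variables (n : nat) (k : 'I_n.+1 -> nat) (A : {set hamming k}).
Hypotheses (A_daisy : daisy_set A) (A_iso : isometric A).

Let k' (j : 'I_n) := k (lift ord0 j).
Let kE : forall j, k' j = k (lift ord0 j) := fun j => erefl.

Definition layer (a : 'I_(k ord0).+1) : {set hamming k'} :=
  [set x | ext k a x \in A].

Lemma layer_le (a : 'I_(k ord0).+1) : a <= k ord0.
Proof. by rewrite -ltnS. Qed.

Lemma layer_daisy a : daisy_set (layer a).
Proof.
have /daisy_setP Acl := A_daisy.
apply/daisy_setP=> x S; rewrite !inE => /(Acl _ (lift ord0 @: S)).
have /negbTE S0 : ord0 \notin lift ord0 @: S.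
  by apply/imsetP=> [[j _ /eqP]]; rewrite (negbTE (neq_lift _ _)).
rewrite (ext_zero kE) mix_ext ?layer_le // S0.
congr (ext k a _ \in A); apply/ffunP=> j; rewrite !ffunE inE.
by rewrite (mem_imset _ _ (@lift_inj _ ord0)).
Qed.

Lemma layer_sub0 a : layer a \subset layer ord0.
Proof.
have /daisy_setP Acl := A_daisy.
apply/subsetP=> x; rewrite !inE => /(Acl _ [set ord0]).
rewrite (ext_zero kE) mix_ext ?layer_le // inE eqxx.
congr (ext k 0 _ \in A); apply/ffunP=> j; rewrite ffunE !inE.
by rewrite eq_sym (negbTE (neq_lift _ _)).
Qed.

Lemma layer_zero a x : x \in layer a -> hzero k' \in layer a.
Proof.
have /daisy_setP cl := layer_daisy a.
move=> /(cl _ setT); suff -> : mix setT x (hzero k') = hzero k' by [].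
by apply/ffunP=> j; rewrite ffunE inE.
Qed.

(** A descent step in [A] corrects one coordinate. Correcting the first one puts [x] in layer [b];
    correcting another one stays in layer [a]. *)
Lemma layer_step a b x y :
  x \in layer a -> y \in layer b -> x != y ->
  (a != b /\ x \in layer b) \/
  exists2 j, x j != y j & mix [set j] x y \in layer a.
Proof.
rewrite !inE => xa yb xy; move/isometric_descending: A_iso => desc.
have le := layer_le.
have ne : ext k a x != ext k b y.
  by apply: contraNneq xy => /(ext_inj kE (le a) (le b)) [_ ->].
have [w [wA adjw lt]] := desc _ _ xa yb ne.
have [i ni ew] := closer_neighbor adjw lt.
move: wA ni; rewrite ew mix_ext ?le //.
case: (unliftP ord0 i) => [j|] ->; rewrite in_set1 => wA ni; [right|left].
  exists j; first by rewrite -(inj_eq val_inj) /= !ext_lift in ni.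
  move: wA; rewrite in_set (negbTE (neq_lift _ _)).
  congr (ext k a _ \in A); apply/ffunP=> c; rewrite !ffunE !inE.
  by rewrite (inj_eq (@lift_inj _ ord0)).
split; first by rewrite -(inj_eq val_inj) /= !ext_ord0 ?le in ni.
move: wA; rewrite eqxx; congr (ext k b _ \in A).
by apply/ffunP=> c; rewrite !ffunE !inE eq_sym (negbTE (neq_lift _ _)).
Qed.

Lemma layer_descend a b x y :
  x \in layer a -> y \in layer b -> x != y ->
  exists z, [/\ z \in layer a :|: layer b, adj x z & hdist z y < hdist x y].
Proof.
move=> xa yb xy.
have fin c j : x j != y j -> mix [set j] x y \in layer c ->
    exists z, [/\ z \in layer c, adj x z & hdist z y < hdist x y].
  move=> h1 h2; exists (mix [set j] x y).
  by rewrite h2 adj_mix1 // (hdist_mix1 h1).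
have [[_ xb]|[j h1 h2]] := layer_step xa yb xy; last first.
  by have [z [za ? ?]] := fin a j h1 h2; exists z; rewrite inE za.
(* Here [x] is already in layer [b], and a step between two vertices of the same layer cannot change
   the first coordinate. *)
have [[]|[j h1 h2]] := layer_step xb yb xy; first by rewrite eqxx.
by have [z [za ? ?]] := fin b j h1 h2; exists z; rewrite inE za orbT.
Qed.

(** As [x] is not in layer [b], the descent step moves within layer [a]; along an edge it reaches
    [y] itself, which is not in layer [a]. *)
Lemma layer_no_edge a b x y :
  x \in layer a :\: layer b -> y \in layer b :\: layer a -> ~~ adj x y.
Proof.
rewrite !in_setD => /andP [xb xa] /andP [ya yb]; apply/negP=> xy.
have ne : x != y by apply: contraNneq xb => ->.
have [[_ h]|[j nj]] := layer_step xa yb ne; first by rewrite h in xb.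
suff -> : mix [set j] x y = y by rewrite (negbTE ya).
apply/ffunP=> c; rewrite ffunE inE; case: (eqVneq c j) => // cj.
exact: adj_eq_off xy nj cj.
Qed.

End Layers.

(** * From isometric daisy graphs to expansion sequences, and minimality *)

Lemma val_embedding (H : sgraph) (B : {set H}) :
  induced_embedding (val : induced B -> H).
Proof. by split=> //; apply: val_inj. Qed.

Lemma daisy_obtained (n : nat) (k : 'I_n -> nat) (G : sgraph)
    (f : G -> hamming k) :
  0 < #|G| -> induced_embedding f -> daisy_set (f @: [set: G]) ->
  isometric (f @: [set: G]) -> obtained_by_daisy_expansions G.
Proof.
elim: n k G f => [|n IH] k G f /card_gt0P [x0 _] fE fD fiso.
  have all0 x : x = x0 by case: fE => fI _; apply: fI; apply/ffunP=> [[]].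
  apply: obtained_K1; exists (fun=> ord0); split.
    by exists (fun=> x0) => [x|x]; [rewrite (all0 x) | rewrite (ord1 x)].
  by move=> x y; rewrite (all0 x) (all0 y) !adj_irr.
set A := f @: [set: G] in fD fiso.
pose k' (j : 'I_n) := k (lift ord0 j).
have kE j : k' j = k (lift ord0 j) by [].
pose L := layer A; pose B := L ord0.
(* These are the indices of the nonempty layers, since a nonempty layer contains zero. *)
pose S := [set a | hzero k' \in L a].
have mem_layer u : u \in A ->
    exists x, [/\ u = ext k (u ord0) x, x \in L (u ord0) & x \in B].
  have [x e] := ext_split u => uA.
  have xL : x \in L (u ord0) by rewrite inE -e.
  by exists x; split=> //; apply: (subsetP (layer_sub0 fD _) _ xL).
have zeroB : hzero k' \in B.
  have [x [_ _ xB]] := mem_layer (f x0) (imset_f f (in_setT x0)).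
  exact: layer_zero xB.
have S0 : ord0 \in S by rewrite inE.
have [l [h [hI h0 hS]]] := pointed_enumeration S0.
pose G' := induced B; pose e : G' -> hamming k' := val.
pose W i : {set G'} := [set x | val x \in L (h i)].
have memW i x : (x \in W i) = (val x \in L (h i)) by rewrite in_set.
have eE : induced_embedding e by apply: val_embedding.
have imW i : e @: W i = L (h i).
  apply/setP=> x; apply/imsetP/idP=> [[y yW ->]|xL]; first by rewrite memW in yW.
  have xB := subsetP (layer_sub0 fD _) _ xL.
  by exists (exist _ x xB : G'); rewrite // memW.
have W0 : W ord0 = [set: G'].
  by apply/setP=> x; rewrite memW h0 in_setT; apply: (valP x).
have imB : e @: [set: G'] = B by rewrite -W0 imW h0.
have WWdesc i j : descending (fun x y => hdist (e x) (e y)) (W i :|: W j).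
  (* Layer descent is transported to [G']: the new vertex lies in some layer, hence in the zero
     layer [B]. *)
  have wlog_desc a b x y : x \in W a -> y \in W b -> x != y ->
      exists z, [/\ z \in W a :|: W b, adj x z
                  & hdist (e z) (e y) < hdist (e x) (e y)].
    rewrite !memW => xa yb xy.
    have [z [zab xz lt]] := layer_descend fiso xa yb xy.
    have zB : z \in B.
      by move: zab; rewrite inE => /orP [] /(subsetP (layer_sub0 fD _)).
    by exists (exist _ z zB : G'); split=> //; rewrite in_setU !memW -in_setU.
  move=> x y /setUP [] xa /setUP [] yb xy.
  - have [z [zW ? ?]] := wlog_desc _ _ _ _ xa yb xy; exists z; split=> //.
    by rewrite setUid in zW; rewrite inE zW.
  - exact: wlog_desc xa yb xy.
  - by rewrite setUC; apply: wlog_desc xa yb xy.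
  - have [z [zW ? ?]] := wlog_desc _ _ _ _ xa yb xy; exists z; split=> //.
    by rewrite setUid in zW; rewrite inE zW orbT.
have Wdesc i : descending (fun x y => hdist (e x) (e y)) (W i).
  by rewrite -[W i]setUid.
have Gdesc : descending (fun x y => hdist (e x) (e y)) [set: G'].
  by rewrite -W0.
have eL := embedding_lipschitz eE.
apply: (@obtained_step G').
  apply: (IH k' G' e) => //; last exact/(isometric_embedding eE).
    by apply/card_gt0P; exists (exist _ (hzero k') zeroB : G').
  by rewrite imB; apply: layer_daisy.
exists l, W; split.
- split.
  + exact: descending_connected Gdesc.
  + move=> i j _; apply/set0Pn; exists (exist _ (hzero k') zeroB : G').
    have zero_in c : hzero k' \in L (h c).
      have : h c \in S by apply/hS; exists c.
      by rewrite inE.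
    by rewrite in_setI !memW !zero_in.
  + apply/setP=> x; rewrite inE; apply/bigcupP; exists ord0 => //.
    by rewrite W0 inE.
  + move=> i j x y; rewrite !in_setD !memW => xi yj.
    have := @layer_no_edge _ _ _ fiso (h i) (h j) (val x) (val y).
    by rewrite !in_setD; apply.
  + by split=> [i|i j]; apply/(isometricP _ eL Gdesc).
- exact: W0.
- exists n, k', e; split=> //.
    by rewrite imB; apply: layer_daisy.
  by move=> i _; rewrite imW; apply: layer_daisy.
have hI' : injective (fun i => nat_of_ord (h i)) by move=> i j /val_inj /hI.
have hle i : nat_of_ord (h i) <= k ord0 by rewrite -ltnS.
(* Labelled by the layer values, the expansion embeds in the same Hamming graph as [G]; it remains
   to see that the images coincide. *)
apply: (embeddings_iso fE (exp_embed_induced kE W eE hI' hle)).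
apply/setP=> u; apply/idP/imsetP=> [uA|[[[x i] xi] _ ->]]; last first.
  have xL : val x \in L (h i) by rewrite -memW.
  by rewrite in_set in xL.
have [x [eu xL xB]] := mem_layer u uA.
have /hS [i ei] : u ord0 \in S by rewrite inE; apply: layer_zero xL.
have xi : (exist _ x xB : G') \in W i by rewrite memW ei.
by exists (exist _ (exist _ x xB : G', i) xi); rewrite // /exp_embed /= ei.
Qed.

(** Passing to a smaller Hamming graph lowers the number of factors or, for equally many factors,
    the sum of the [k i]; so the descent ends. Excluded middle decides whether a smaller one
    exists. *)
Lemma smallest_exists (G : sgraph) (n : nat) (k : 'I_n -> nat) :
  isometric_daisy_graph G k ->
  exists (m : nat) (r : 'I_m -> nat), smallest_isometric_daisy_graph G r.
Proof.
elim/ltn_ind: n k => n IHn k.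
have [s] := ubnP (\sum_i k i); elim: s k => // s IHs k ks Gk.
have [[m [r [fs Gr]]]|none] := classic (exists (m : nat) (r : 'I_m -> nat),
  fewer_or_smaller r k /\ isometric_daisy_graph G r); last first.
  by exists n, k; split=> // m r fs Gr; apply: none; exists m, r.
case: fs => [lt|[t [tB tle [j tlt]]]]; first exact: IHn lt r Gr.
have mn : m = n by have := bij_eq_card tB; rewrite !card_ord.
subst m; apply: (IHs r) Gr; rewrite ltnS in ks; apply: leq_trans ks.
rewrite (reindex t (F := k)) /=; last exact: onW_bij.
rewrite (bigD1 j) //= [leqRHS](bigD1 j) //= -addSn.
by apply: leq_add => //; apply: leq_sum.
Qed.

Theorem theorem3p8 (G : sgraph) (G_nonempty : 0 < #|G|) :
  (exists (n : nat) (k : 'I_n -> nat), smallest_isometric_daisy_graph G k)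
  <-> obtained_by_daisy_expansions G.
Proof.
split=> [[n [k [[f [fE fD fiso]] _]]]|obt]; first exact: daisy_obtained fD fiso.
suff [n [k /smallest_exists]] :
  exists (n : nat) (k : 'I_n -> nat), isometric_daisy_graph G k by [].
elim: obt => {G G_nonempty} [G [p [[q pK _] pM]]|G' G _ [m [r Gr]] exp]; last first.
  exact: expansion_daisy Gr exp.
(* The one-vertex graph is the Hamming graph of the empty product. *)
exists 0, (fun=> 0), (fun=> hzero _).
have all_eq (x y : G) : x = y by rewrite -(pK x) -(pK y) !(ord1 (p _)).
have all0 (u v : hamming (fun _ : 'I_0 => 0)) : u = v by apply/ffunP=> [[]].
split.
- split=> [x y _|x y]; first exact: all_eq.
  by rewrite (all_eq x y) !adj_irr.
- by apply/daisy_setP=> u S uA; rewrite (all0 (mix S u _) u).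
- by apply/isometric_descending=> u v _ _; rewrite (all0 u v) eqxx.
Qed.
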